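(* For every positive integer $D$, there exist a $3$-uniform $2$-simple hypergraph $\mathcal{H}$ of maximum degree at most $D$ and an edge $e\in E(\mathcal{H})$ such that $$b_{L(\mathcal{H}),\,3D}(e)\ge 1-\frac{2}{9}+\frac{2}{3^5}-o(1),$$ where the $o(1)$ term depends only on $D$ and goes to $0$ as $D\to\infty$.
   Context: A hypergraph $\mathcal{H}$ consists of a vertex set $V(\mathcal{H})$ and a multiset $E(\mathcal{H})$ of edges, each a subset of $V(\mathcal{H})$ (copies of a repeated edge count as distinct edges). It is $k$-uniform if every edge has size $k$, and $t$-simple if every two distinct edges intersect in at most $t$ vertices. The degree of a vertex is the number of edges (with multiplicity) containing it. The line graph $L(\mathcal{H})$ is the simple graph whose vertices are the edges of $\mathcal{H}$ (with multiplicity), two distinct edges being adjacent iff they intersect. For a graph $G$ and $v\in V(G)$, let $P_G(v):=\binom{\deg_G(v)}{2}-|E(N_G(v))|$ be the number of non-adjacent (unordered) pairs of distinct vertices in $N_G(v)$, where $E(N_G(v))$ is the set of edges of $G$ with both ends in $N_G(v)$, and let $T_G(v)$ be the number of $3$-element subsets of $N_G(v)$ that are pairwise non-adjacent in $G$. For a number $M\ge\Delta(G)$, define $$b_{G,M}(v):=\frac{\deg_G(v)}{M}-\frac{P_G(v)}{M^2}+\frac{T_G(v)}{M^3}.$$ *)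

(* Defs.v *)
From mathcomp Require Import all_boot all_order all_algebra.

Set Implicit Arguments.
Unset Strict Implicit.
Unset Printing Implicit Defensive.

Import GRing.Theory Num.Theory.

(* Edges are indexed by a finite type, so that several indices may carry the
   same vertex set: this is a multiset of edges, and "distinct edges" means
   distinct indices. *)
Record hypergraph := Hypergraph {
  hvertex : finType;
  hedge : finType;
  ends : hedge -> {set hvertex} }.

Section Hypergraph.
Variable H : hypergraph.

Definition uniform (k : nat) : Prop := forall e : hedge H, #|ends e| = k.

Definition simple (t : nat) : Prop :=
  forall e f : hedge H, e != f -> #|ends e :&: ends f| <= t.

Definition hdeg (x : hvertex H) : nat := #|[set e : hedge H | x \in ends e]|.

Definition hmaxdeg : nat := \max_(x : hvertex H) hdeg x.

End Hypergraph.

Record sgraph := SGraph {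
  svertex : finType;
  adj : rel svertex;
  adj_sym : symmetric adj;
  adj_irr : irreflexive adj }.

Section Graph.
Variable G : sgraph.
Implicit Types (v : svertex G) (A : {set svertex G}).

Definition nbh v : {set svertex G} := [set w | adj v w].

Definition deg v : nat := #|nbh v|.

Definition maxdeg : nat := \max_(v : svertex G) deg v.

Definition edges_in A : {set {set svertex G}} :=
  [set [set x; y] | x in A, y in A & adj x y].

Definition stable A : bool := [forall x in A, forall y in A, ~~ adj x y].

Definition stable_subsets (k : nat) A : {set {set svertex G}} :=
  [set S : {set svertex G} | [&& S \subset A, #|S| == k & stable S]].

(* The subtraction never truncates, see [card_edges_in] and [numPE] below. *)
Definition numP v : nat := 'C(deg v, 2) - #|edges_in (nbh v)|.

Definition numT v : nat := #|stable_subsets 3 (nbh v)|.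

Definition bG (R : realFieldType) (M : R) v : R :=
  ((deg v)%:R / M - (numP v)%:R / M ^+ 2 + (numT v)%:R / M ^+ 3)%R.

Lemma edges_inE A :
  edges_in A = [set S : {set svertex G} |
                 [&& S \subset A, #|S| == 2 & ~~ stable S]].
Proof.
apply/setP=> S; rewrite inE; apply/imset2P/and3P.
  case=> x y xA /[!inE] /andP[yA xy] ->; split.
  - by rewrite subUset !sub1set xA.
  - by rewrite cards2; case: (eqVneq x y) xy => // ->; rewrite adj_irr.
  - apply/negP=> /forall_inP/(_ x); rewrite !inE eqxx => /(_ isT).
    by move=> /forall_inP/(_ y); rewrite !inE eqxx orbT => /(_ isT)/negP.
case=> SA /cards2P[x [y] [xy eS]]; rewrite {}eS in SA *.
move: SA; rewrite subUset !sub1set => /andP[xA yA].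
case/forall_inPn=> u /[!inE] uS /forall_inPn[w /[!inE] wS] /negPn uw.
exists x y; rewrite // inE yA /=.
by case/orP: uS uw => /eqP->; case/orP: wS => /eqP->; rewrite ?adj_irr // adj_sym.
Qed.

Lemma card_edges_in A :
  #|edges_in A| + #|stable_subsets 2 A| = 'C(#|A|, 2).
Proof.
rewrite -cards_draws addnC -(cardsID [set S | stable S]).
by congr (_ + _); apply: eq_card => S; rewrite ?edges_inE !inE; case: (_ \subset _) (_ == _) (stable _) => [] [] [].
Qed.

Lemma numPE v : numP v = #|stable_subsets 2 (nbh v)|.
Proof. by rewrite /numP -card_edges_in addKn. Qed.

End Graph.

Section LineGraph.
Variable H : hypergraph.

Definition meets : rel (hedge H) :=
  fun e f => (e != f) && (ends e :&: ends f != set0).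

Lemma meets_sym : symmetric meets.
Proof. by move=> e f; rewrite /meets eq_sym setIC. Qed.

Lemma meets_irr : irreflexive meets.
Proof. by move=> e; rewrite /meets eqxx. Qed.

Definition line_graph : sgraph := SGraph meets_sym meets_irr.

(* The side condition [M >= maxdeg G] of [bG] for [G = line_graph H] and
   [M = k * D]. *)
Lemma maxdeg_line_graph (k D : nat) :
  uniform H k -> hmaxdeg H <= D -> maxdeg line_graph <= k * D.
Proof.
move=> Hk HD; apply/bigmax_leqP=> e _.
apply: (@leq_trans #|\bigcup_(x in ends (e : hedge H)) [set f | x \in ends f]|).
  apply/subset_leq_card/subsetP=> f; rewrite inE => /andP[_ /set0Pn[x]].
  by rewrite inE => /andP[xe xf]; apply/bigcupP; exists x; rewrite ?inE.
have big_card I (r : seq I) (Q : pred I) (F : I -> {set hedge H}) :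
    #|\bigcup_(i <- r | Q i) F i| <= \sum_(i <- r | Q i) #|F i|.
  elim/big_ind2: _ => [|A m B n Am Bn|//]; first by rewrite cards0.
  exact: leq_trans (leq_card_setU _ _) (leq_add Am Bn).
apply: (leq_trans (big_card _ _ _ _)).
rewrite -(Hk e) -sum_nat_const; apply: leq_sum => x _.
exact: leq_trans (leq_bigmax x) HD.
Qed.

End LineGraph.

(* Main.v *)
Require Import Defs.
From mathcomp Require Import all_boot all_order all_algebra.
From mathcomp Require Import all_classical all_reals all_analysis.
From mathcomp Require Import perm ring lra zify.

Import Order.TTheory GRing.Theory Num.Theory numFieldNormedType.Exports.

(** Inclusion-exclusion over the neighbourhood of [e] in the line graph charges
    every pair of disjoint edges meeting [e], so [e = {x_1, x_2, x_3}] should be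
    surrounded by edges that meet one another as often as the degree bound
    allows.  A vertex [y] outside [e] creates the most meetings between edges
    through different [x_i] when its degree [D] is split evenly among the three
    [x_i]; this leads to three hubs [y_1, y_2, y_3], with [K ~ D / 3] edges
    [{x_i, y_j, z}] for each [(i, j)].  Giving every such edge its own third
    vertex [z] keeps the hypergraph 2-simple.

    The neighbours of [e] are then the edges labelled [(i, j, k)], and two of
    them are disjoint exactly when they differ both in [i] and in [j]: the line
    graph induced on them is the 3 x 3 rook's graph with every cell replaced by
    a [K]-clique.  Hence [e] has degree [9 K], there are [3 * 6 * K^2] disjoint
    pairs ([card_stable2]), and placing three non-attacking rooks gives [3! * K^3]
    pairwise disjoint triples ([card_stable3]).  With [t = K / D] this yields
    [b(e) >= 3 t - 2 t^2 + (2 / 9) t^3], which at [t = 1 / 3] is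
    [1 - 2 / 9 + 2 / 3^5]; since [1 / 3 - t <= 1 / D], the loss is at most
    [3 / D] ([cubic_near_third]). *)

Section RookHypergraph.
Variable K : nat.

Definition label : finType := ('I_3 * 'I_3 * 'I_K)%type.

(** [inl (inl i)] is the vertex [x_i] of the central edge, [inl (inr j)] the hub
    [y_j], and [inr a] the private vertex of the edge labelled [a]. *)
Definition rook_vertex : finType := ('I_3 + 'I_3 + label)%type.

Definition rook_ends (e : option label) : {set rook_vertex} :=
  if e is Some a then [set inl (inl a.1.1); inl (inr a.1.2); inr a]
  else [set inl (inl i) | i : 'I_3].

Definition rook_hypergraph := Hypergraph rook_ends.

Notation H := rook_hypergraph.
Notation G := (line_graph H).

Lemma rook_uniform : uniform H 3.
Proof.
case=> [a|] /=; first by rewrite finset.setUC cardsU1 cards2 !inE.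
by rewrite card_imset ?card_ord // => i j [].
Qed.

Lemma private_vertex (a : label) (e : option label) :
  (inr a \in rook_ends e) = (e == Some a).
Proof.
case: e => [b|] /=; first by rewrite !inE /= eq_sym; apply/eqP/eqP=> [[->]|[->]].
by apply/negbTE/imsetP=> -[].
Qed.

(** Of two distinct edges at least one is not the central edge, and its private
    vertex lies outside the intersection. *)
Lemma rook_simple : simple H 2.
Proof.
have private_lost (a : label) (f : option label) :
    f != Some a -> #|rook_ends (Some a) :&: rook_ends f| <= 2.
  move=> fa; rewrite -ltnS -(rook_uniform (Some a)); apply: proper_card.
  apply/properP; split; first exact: finset.subsetIl.
  by exists (inr a); rewrite ?inE ?private_vertex ?eqxx ?(negbTE fa).
case=> [a|] f; first by rewrite eq_sym; apply: private_lost.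
by case: f => // b ne; rewrite finset.setIC; apply: private_lost.
Qed.

Lemma rook_maxdeg : hmaxdeg H <= (3 * K).+1.
Proof.
have card_line : #|{: 'I_3 * 'I_K}| = 3 * K by rewrite card_prod !card_ord.
apply/bigmax_leqP=> -[[i|j]|a] _; rewrite /hdeg.
- pose line := [set Some (i, p.1, p.2) | p : 'I_3 * 'I_K] : {set option label}.
  apply: (@leq_trans #|None |: line|).
    apply/subset_leq_card/fintype.subsetP=> -[[[i' j'] k]|]; rewrite !inE //=.
    move=> /orP[/orP[]|] /eqP // [ii'].
    by apply/imsetP; exists (j', k); rewrite // ii'.
  by rewrite cardsU1 -add1n leq_add ?leq_b1 // -card_line leq_imset_card.
- pose line := [set Some (p.1, j, p.2) | p : 'I_3 * 'I_K] : {set option label}.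
  apply: (@leq_trans #|line|).
    apply/subset_leq_card/fintype.subsetP=> -[[[i' j'] k]|]; rewrite !inE //=.
      move=> /orP[] // /eqP[jj'].
      by apply/imsetP; exists (i', k); rewrite // jj'.
    by case/imsetP.
  by rewrite -card_line (leq_trans (leq_imset_card _ _)).
- rewrite (@fintype.eq_card1 _ (Some a)) // => e.
  by rewrite inE private_vertex.
Qed.

Lemma central_nbh : @nbh G None = [set~ None].
Proof.
apply/setP=> -[[[i j] k]|]; rewrite !inE /= /Defs.meets ?eqxx //=.
apply/set0Pn; exists (inl (inl i)); rewrite !inE eqxx andbT.
by apply/imsetP; exists i.
Qed.

Lemma central_deg : @deg G None = 9 * K.
Proof.
by rewrite /deg central_nbh cardsC1 card_option !card_prod !card_ord.
Qed.

(** Private vertices never contribute to an intersection, so only the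
    coordinates in the 3 x 3 board matter. *)
Lemma meets_labels (a b : label) :
  @adj G (Some a) (Some b) =
  (a != b) && ((a.1.1 == b.1.1) || (a.1.2 == b.1.2)).
Proof.
rewrite /= /Defs.meets /=; case: (eqVneq a b) => [->|ab]; first by rewrite eqxx.
have -> /= : Some a != Some b by apply: contraNneq ab => -[ab]; rewrite ab.
apply/set0Pn/orP=> [[v]|].
  case: v => [[i|j]|c]; rewrite !inE /= => /andP[].
  - by case/orP=> [/orP[]|] /eqP // [->] /orP[/orP[]|] /eqP // [->]; left.
  - by case/orP=> /eqP // [->] /orP[] /eqP // [->]; right.
  - by move=> /eqP[->] /eqP[eab]; rewrite eab eqxx in ab.
by case=> /eqP e; [exists (inl (inl a.1.1))|exists (inl (inr a.1.2))];
   rewrite !inE e !eqxx ?orbT.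
Qed.

(** A disjoint pair has two different rows, so it can be listed with the smaller
    row first; there are 3 pairs of rows and 6 ordered pairs of columns. *)
Lemma card_stable2 : #|stable_subsets 2 (@nbh G None)| <= 18 * K ^ 2.
Proof.
pose rows := [set p : 'I_3 * 'I_3 | p.1 < p.2].
pose cols := [set q : 'I_3 * 'I_3 | q.1 != q.2].
have card_rows : #|rows| = 3.
  rewrite -sum1dep_card (big_mkcond (fun p : 'I_3 * 'I_3 => p.1 < p.2)).
  by rewrite -(pair_bigA _ (fun i j : 'I_3 => if i < j then 1 else 0)) /=
             !big_ord_recl !big_ord0.
have card_cols : #|cols| = 6.
  rewrite -sum1dep_card (big_mkcond (fun p : 'I_3 * 'I_3 => p.1 != p.2)).
  by rewrite -(pair_bigA _ (fun i j : 'I_3 => if i != j then 1 else 0)) /=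
             !big_ord_recl !big_ord0.
pose params := finset.setX (finset.setX rows cols) [set: 'I_K * 'I_K].
pose pair_of (u : ('I_3 * 'I_3) * ('I_3 * 'I_3) * ('I_K * 'I_K)) :
    {set option label} :=
  [set Some (u.1.1.1, u.1.2.1, u.2.1); Some (u.1.1.2, u.1.2.2, u.2.2)].
have -> : 18 * K ^ 2 = #|params|.
  by rewrite !cardsX card_rows card_cols cardsT card_prod !card_ord.
apply: leq_trans (leq_imset_card pair_of _).
apply/subset_leq_card/fintype.subsetP=> S; rewrite inE => /and3P[SN /cards2P[e [f [ef eS]]]].
rewrite {}eS finset.subUset !finset.sub1set central_nbh !inE in SN *.
case: e f ef SN => [[[i j] k]|] [[[i' j'] k']|] //= ef _ /forall_inP st.
have /st/forall_inP/(_ (Some (i', j', k'))) :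
  Some (i, j, k) \in [set Some (i, j, k); Some (i', j', k')] by rewrite set21.
rewrite set22 meets_labels => /(_ isT).
have -> /= : (i, j, k) != (i', j', k') by apply: contraNneq ef => ->.
rewrite negb_or => /andP[ii' jj'].
case: (ltngtP i i') => [lt|gt|/val_inj e]; last by rewrite e eqxx in ii'.
  by apply/imsetP; exists ((i, i'), (j, j'), (k, k')); rewrite ?inE /= ?lt ?jj'.
by rewrite finset.setUC; apply/imsetP; exists ((i', i), (j', j), (k', k));
  rewrite ?inE /= ?gt 1?eq_sym ?jj'.
Qed.

(** Three rooks, one in each row [i], at the columns [s i] given by a
    permutation, and any choice of copies [f i]. *)
Lemma card_stable3 : 6 * K ^ 3 <= #|stable_subsets 3 (@nbh G None)|.
Proof.
pose rooks (u : {perm 'I_3} * {ffun 'I_3 -> 'I_K}) : {set option label} :=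
  [set Some (i, u.1 i, u.2 i) | i : 'I_3].
have rooks_inj : injective rooks.
  move=> [s f] [s' f'] /setP eq_rooks.
  have same i : s i = s' i /\ f i = f' i.
    have := eq_rooks (Some (i, s i, f i)).
    rewrite [X in X = _]imset_f // => /esym/imsetP[i' _ /= [-> <- <-]].
    by [].
  by congr pair; [apply/permP|apply/ffunP] => i; case: (same i).
have -> : 6 * K ^ 3 = #|[set: {perm 'I_3} * {ffun 'I_3 -> 'I_K}]|.
  by rewrite cardsT card_prod card_Sn card_ffun !card_ord.
rewrite -(card_imset _ rooks_inj); apply/subset_leq_card/fintype.subsetP=> S.
case/imsetP=> -[s f] _ ->; rewrite inE; apply/and3P; split.
- by apply/fintype.subsetP=> e /imsetP[i _ ->]; rewrite central_nbh !inE.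
- by rewrite card_imset ?card_ord // => i j [].
apply/forall_inP=> e /imsetP[i _ ->]; apply/forall_inP=> e' /imsetP[j _ ->].
rewrite meets_labels /= (inj_eq perm_inj) orbb.
by case: (eqVneq i j) => [->|_]; rewrite ?eqxx ?andbF.
Qed.

End RookHypergraph.

Local Open Scope classical_set_scope.
Local Open Scope ring_scope.

(** The linear term alone accounts for a loss of [3 (1 / 3 - t)]; the other two
    terms together decrease in [t], which only helps. *)
Lemma cubic_near_third (R : realFieldType) (t : R) : 0 <= t -> t <= 1 / 3 ->
  1 - 2 / 9 + 2 / 3 ^+ 5 - (1 - 3 * t) <= 3 * t - 2 * t ^+ 2 + 2 / 9 * t ^+ 3.
Proof.
move=> t0 t3; rewrite -subr_ge0.
have -> : 3 * t - 2 * t ^+ 2 + 2 / 9 * t ^+ 3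
    - (1 - 2 / 9 + 2 / 3 ^+ 5 - (1 - 3 * t))
  = 2 * (1 / 3 - t) * ((1 / 3 + t) - (1 / 9 + t / 3 + t ^+ 2) / 9) by field.
have : t ^+ 2 <= 1 by nra.
by move=> t2; rewrite !mulr_ge0 //; lra.
Qed.

Lemma rook_bG (R : realFieldType) (K D : nat) (t := K%:R / D%:R : R) :
  (0 < D)%N ->
  3 * t - 2 * t ^+ 2 + 2 / 9 * t ^+ 3
    <= @bG (line_graph (rook_hypergraph K)) R (3 * D)%:R None.
Proof.
move=> D0; have Dn0 : D%:R != 0 :> R by rewrite pnatr_eq0 -lt0n.
have -> : 3 * t - 2 * t ^+ 2 + 2 / 9 * t ^+ 3
  = (9 * K)%N%:R / (3 * D)%:R - (18 * K ^ 2)%N%:R / (3 * D)%:R ^+ 2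
    + (6 * K ^ 3)%N%:R / (3 * D)%:R ^+ 3 :> R.
  by rewrite /t !natrM; field.
rewrite /bG central_deg numPE; apply: lerD; first apply: lerB => //.
  by rewrite ler_wpM2r ?invr_ge0 ?exprn_ge0 ?ler_nat ?card_stable2.
by rewrite ler_wpM2r ?invr_ge0 ?exprn_ge0 ?ler_nat ?card_stable3.
Qed.

Theorem lemma3p5 (R : realType) :
  exists2 eps : nat -> R, eps @ \oo --> (0 : R) &
    forall D : nat, (0 < D)%N ->
      exists H : hypergraph,
        [/\ uniform H 3, simple H 2, (hmaxdeg H <= D)%N
          & exists e : hedge H,
              @bG (line_graph H) R (3 * D)%:R e
                >= 1 - 2 / 9 + 2 / 3 ^+ 5 - eps D].
Proof.
exists (fun D => 3 * D%:R^-1).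
  rewrite -[0 in X in _ --> X](mulr0 3); apply: cvgMr.
  by rewrite -cvg_shiftS; exact: cvg_harmonic.
move=> D D0.
(* The vertices [x_i] have degree [3 K + 1], the extra edge being the central
   one. *)
pose K := (D.-1 %/ 3)%N.
have KD : ((3 * K).+1 <= D)%N by rewrite /K; lia.
have DK : (D <= 3 * K + 3)%N by rewrite /K; lia.
exists (rook_hypergraph K); split.
- exact: rook_uniform.
- exact: rook_simple.
- exact: leq_trans (rook_maxdeg K) KD.
exists None; apply: le_trans (rook_bG R K D D0).
have Dp : 0 < D%:R :> R by rewrite ltr0n.
have t3 : K%:R / D%:R <= 1 / 3 :> R.
  rewrite ler_pdivrMr // mul1r mulrC ler_pdivlMr // -natrM ler_nat; lia.
apply: le_trans (cubic_near_third R _ _ t3); last by rewrite divr_ge0.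
rewrite lerD2l lerN2 -(ler_pM2r Dp) mulrBl mul1r -!mulrA mulVf ?gt_eqF //.
by rewrite !mulr1 lerBlDr -natrM -natrD ler_nat addnC.
Qed.
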